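(* Let $M \in \mathbb{R}^{m \times n}$, and let $M_{r-1}$ be its best rank-$(r-1)$ approximation with respect to the norm $\|\cdot\|$. Then $$\inf_{U \in \mathbb{R}^{m \times r},\, V \in \mathbb{R}^{r \times n}_+} \|M - UV\| \leq \|M - M_{r-1}\|.$$ Moreover, for the Frobenius norm, the solution $(U,V)$ provided by the coordinate descent algorithm CD (defined in the context) initialized with the SVD-based initialization INIT (defined in the context) satisfies this bound, i.e., $\|M - UV\|_F \leq \|M - M_{r-1}\|_F$, where $M_{r-1}$ is a best rank-$(r-1)$ approximation of $M$ in the Frobenius norm.
   Context: $\mathbb{R}^{r\times n}_+$ is the set of component-wise nonnegative $r \times n$ matrices; $e$ is the vector of all ones of appropriate dimension; $A(:,i)$ and $B(i,:)$ denote the $i$th column of $A$ and the $i$th row of $B$. A best rank-$(r-1)$ approximation of $M$ with respect to $\|\cdot\|$ is a minimizer of $\|M - X\|$ over all $X \in \mathbb{R}^{m\times n}$ with $\operatorname{rank}(X) \leq r-1$ (it need not be unique). Algorithm INIT (input $M \in \mathbb{R}^{m\times n}$ and $r$; output $U \in \mathbb{R}^{m \times r}$, $V \in \mathbb{R}^{r\times n}_+$): (1) compute the rank-$(r-1)$ truncated singular value decomposition $A S B$ of $M$, with $A \in \mathbb{R}^{m \times (r-1)}$, $S$ diagonal, $B \in \mathbb{R}^{(r-1) \times n}$; (2) replace $A$ by $AS$; (3) for each $1 \leq i \leq r-1$, multiply $B(i,:)$ and $A(:,i)$ by $-1$ if $\min_j B(i,j) \leq \min_j (-B(i,j))$; (4)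 set $U = [A \;\; -Ae]$; (5) for each $1 \leq j \leq n$, set $V(:,j) = \begin{pmatrix} B(:,j) \\ 0 \end{pmatrix} + \max\left(0, \max_i(-B_{ij})\right) e$. Algorithm CD (input $M \in \mathbb{R}^{m\times n}$, an initial $V \in \mathbb{R}^{r\times n}_+$, and a maximum number of iterations; output $(U,V)$ with $V \geq 0$): at each iteration, first set $U \leftarrow \operatorname{argmin}_{X \in \mathbb{R}^{m\times r}} \|M - XV\|_F^2$; then for $i = 1, \dots, r$ successively set $V(i,:)^T \leftarrow \operatorname{argmin}_{x \in \mathbb{R}^n_+} \|M - U(:,\mathcal{I})V(\mathcal{I},:) - U(:,i)x^T\|_F^2$, where $\mathcal{I} = \{1,\dots,r\} \setminus \{i\}$; when $U(:,i) \neq 0$ this minimizer equals $\max\left(0, \frac{(M - U(:,\mathcal{I})V(\mathcal{I},:))^T U(:,i)}{\|U(:,i)\|_2^2}\right)$, the maximum being taken entrywise. CD initialized with INIT means that CD is run from the matrix $V$ output by INIT. *)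

(* Defs.v *)
From HB Require Import structures.
From mathcomp Require Import all_boot all_order all_algebra.
From mathcomp Require Import all_classical all_reals.

Set Implicit Arguments.
Unset Strict Implicit.
Unset Printing Implicit Defensive.

Import Order.TTheory GRing.Theory Num.Theory.
Local Open Scope classical_set_scope.
Local Open Scope ring_scope.

(* An arbitrary norm is a function and not the library's norm structure: on
   'M[R]_(m, n) the latter is already taken by the max-norm. *)
Definition is_norm (R : realType) (m n : nat) (N : 'M[R]_(m, n) -> R) : Prop :=
  [/\ forall X Y, N (X + Y) <= N X + N Y,
      forall (a : R) X, N (a *: X) = `|a| * N X
    & forall X, N X = 0 -> X = 0].

Definition frob (R : realType) (m n : nat) (X : 'M[R]_(m, n)) : R :=
  Num.sqrt (\sum_(i < m) \sum_(j < n) X i j ^+ 2).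

Definition nonneg_mx (R : realType) (m n : nat) : set 'M[R]_(m, n) :=
  [set X | forall i j, 0 <= X i j].
Arguments nonneg_mx {R m n}.

Definition is_argmin (R : realType) (T : Type) (D : set T) (f : T -> R)
    (x : T) : Prop :=
  D x /\ forall y, D y -> f x <= f y.

Definition best_rank_approx (R : realType) (m n : nat)
    (N : 'M[R]_(m, n) -> R) (k : nat) (M X : 'M[R]_(m, n)) : Prop :=
  is_argmin [set Y : 'M[R]_(m, n) | (\rank Y <= k)%N] (fun Y => N (M - Y)) X.

(* M = P Sigma Q^T; the singular values are indexed by nat and extended by 0
   beyond min(m, n). *)
Definition is_svd (R : realType) (m n : nat) (M : 'M[R]_(m, n))
    (P : 'M[R]_m) (sigma : nat -> R) (Q : 'M[R]_n) : Prop :=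
  [/\ P^T *m P = 1%:M, Q^T *m Q = 1%:M,
      (forall i, 0 <= sigma i) /\ (forall i, (minn m n <= i)%N -> sigma i = 0),
      forall i j, (i <= j)%N -> sigma j <= sigma i
    & M = P *m (\matrix_(i < m, j < n)
                  (if val i == val j then sigma i else 0)) *m Q^T].

(* M has rank-k truncated SVD A (diag_mx s) B. If k > min(m, n), the columns of
   A and the rows of B for which no singular vector is left are unconstrained:
   they are weighted by a zero of s. *)
Definition is_truncated_svd (R : realType) (m n k : nat) (M : 'M[R]_(m, n))
    (A : 'M[R]_(m, k)) (s : 'rV[R]_k) (B : 'M[R]_(k, n)) : Prop :=
  exists (P : 'M[R]_m) (sigma : nat -> R) (Q : 'M[R]_n),
    [/\ is_svd M P sigma Q,
        s = \row_(i < k) sigma i,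
        forall (i : 'I_k) (l : 'I_m), val l = val i -> col i A = col l P
      & forall (i : 'I_k) (l : 'I_n), val l = val i -> row i B = (col l Q)^T].

(* The minima over j are taken in \bar R, whose +oo is neutral for mine. *)
Definition init_sign (R : realType) (k n : nat) (B : 'M[R]_(k, n))
    (i : 'I_k) : R :=
  if (\big[mine/+oo]_(j < n) (B i j)%:E <=
      \big[mine/+oo]_(j < n) (- B i j)%:E)%E then -1 else 1.

(* (U, V) is a possible output of INIT for the factorization rank r = k + 1;
   it depends on the truncated SVD that is chosen.
   \big[Num.max/0] is max(0, max_l ...), also when k = 0. *)
Definition INIT (R : realType) (m n k : nat) (M : 'M[R]_(m, n))
    (U : 'M[R]_(m, k + 1)) (V : 'M[R]_(k + 1, n)) : Prop :=
  exists (A0 : 'M[R]_(m, k)) (s : 'rV[R]_k) (B0 : 'M[R]_(k, n)),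
    is_truncated_svd M A0 s B0 /\
    let D := diag_mx (\row_(i < k) init_sign B0 i) in
    let A := (A0 *m diag_mx s) *m D in
    let B := D *m B0 in
    U = row_mx A (- (A *m const_mx 1)) /\
    V = col_mx B 0 +
        \matrix_(i < k + 1, j < n) \big[Num.max/0]_(l < k) (- B l j).

Definition U_update (R : realType) (m n r : nat) (M : 'M[R]_(m, n))
    (V : 'M[R]_(r, n)) (U : 'M[R]_(m, r)) : Prop :=
  is_argmin setT (fun X : 'M[R]_(m, r) => frob (M - X *m V) ^+ 2) U.

(* The vector x of R^n is represented by the row x^T. *)
Definition V_row_update (R : realType) (m n r : nat) (M : 'M[R]_(m, n))
    (U : 'M[R]_(m, r)) (i : 'I_r) (V V' : 'M[R]_(r, n)) : Prop :=
  (forall l, l != i -> row l V' = row l V) /\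
  is_argmin nonneg_mx
    (fun x : 'rV[R]_n =>
       frob (M - \sum_(l < r | l != i) col l U *m row l V - col i U *m x) ^+ 2)
    (row i V').

(* W i is the value of V once its first i rows have been updated. *)
Definition CD_step (R : realType) (m n r : nat) (M : 'M[R]_(m, n))
    (V : 'M[R]_(r, n)) (U : 'M[R]_(m, r)) (V' : 'M[R]_(r, n)) : Prop :=
  U_update M V U /\
  exists W : nat -> 'M[R]_(r, n),
    [/\ W 0%N = V,
        forall i : 'I_r, V_row_update M U i (W i) (W i.+1)
      & W r = V'].

(* CD M V0 K U V: after K iterations from V0, CD may return (U, V). This is a
   relation since the minimizers need not be unique, and K >= 1 since U is
   undefined before the first iteration. *)
Inductive CD (R : realType) (m n r : nat) (M : 'M[R]_(m, n))
    (V0 : 'M[R]_(r, n)) : nat -> 'M[R]_(m, r) -> 'M[R]_(r, n) -> Prop :=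
| CD_first U V : CD_step M V0 U V -> CD M V0 1 U V
| CD_next K U V U' V' :
    CD M V0 K U V -> CD_step M V U' V' -> CD M V0 K.+1 U' V'.

(* Main.v *)
(* If a rank-k matrix is A B, adding the column - A e to A makes the columns of
   the left factor sum to zero, so any multiple of e may be added to each column
   of the right factor [B; 0] without changing the product; large enough
   multiples make it nonnegative. INIT does this for the truncated SVD, and CD
   never increases the error because the current iterate is feasible in each of
   its subproblems. It remains to see that the truncated SVD is optimal: for Y
   of rank at most k, let E be the orthogonal projector onto the kernel of Y.
   Then |M - Y|^2 >= |(M - Y) E|^2 = |M E|^2, which in a singular basis is
   \sum_j sigma_j^2 E_jj, with 0 <= E_jj <= 1 and \tr E >= n - k; since the
   sigma_j decrease, this is at least \sum_(j >= k) sigma_j^2. *)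
Require Import Defs.
From HB Require Import structures.
From mathcomp Require Import all_boot all_order all_algebra.
From mathcomp Require Import all_classical all_reals.

Set Implicit Arguments.
Unset Strict Implicit.
Unset Printing Implicit Defensive.

Import Order.TTheory GRing.Theory Num.Theory.
Local Open Scope classical_set_scope.
Local Open Scope ring_scope.

(** * Orthogonal projectors and low-rank approximation of a diagonal matrix *)

Lemma mxtrace_tr_mul_sum (R : comNzRingType) (m n : nat) (X : 'M[R]_(m, n)) :
  \tr (X *m X^T) = \sum_(i < m) \sum_(j < n) X i j ^+ 2.
Proof.
by apply: eq_bigr => i _; rewrite mxE; apply: eq_bigr => j _; rewrite mxE expr2.
Qed.

Lemma mxtrace_mul_tr_ge0 (R : realDomainType) (m n : nat) (X : 'M[R]_(m, n)) :
  0 <= \tr (X *m X^T).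
Proof.
rewrite mxtrace_tr_mul_sum; apply: sumr_ge0 => i _.
by apply: sumr_ge0 => j _; exact: sqr_ge0.
Qed.

Lemma mxtrace_mul_tr_eq0 (R : realDomainType) (m n : nat) (X : 'M[R]_(m, n)) :
  \tr (X *m X^T) = 0 -> X = 0.
Proof.
rewrite mxtrace_tr_mul_sum => /eqP; rewrite psumr_eq0; last first.
  by move=> i _; apply: sumr_ge0 => j _; exact: sqr_ge0.
move=> /allP X0; apply/matrixP => i j; rewrite mxE.
have := X0 i (mem_index_enum i); rewrite /= psumr_eq0; last first.
  by move=> l _; exact: sqr_ge0.
by move=> /allP /(_ j (mem_index_enum j)) /=; rewrite sqrf_eq0 => /eqP.
Qed.

(** If [v] kills the Gram matrix, then [v *m D] has squared norm 0. *)
Lemma gram_unitmx (R : realFieldType) (p n : nat) (D : 'M[R]_(p, n)) :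
  row_free D -> D *m D^T \in unitmx.
Proof.
move=> fD; rewrite -row_free_unit; apply: inj_row_free => v vG.
have vD0 : v *m D = 0.
  apply: mxtrace_mul_tr_eq0.
  by rewrite trmx_mul mulmxA -(mulmxA v) vG mul0mx linear0.
by apply: (row_free_inj fD); rewrite vD0 mul0mx.
Qed.

Lemma orth_projector_ker (R : realFieldType) (m n : nat) (Y : 'M[R]_(m, n)) :
  exists E : 'M[R]_n, [/\ E^T = E, E *m E = E, Y *m E = 0
    & \tr E = n%:R - (\rank Y)%:R].
Proof.
have [C [D [YE fD]]] : exists C D, Y = C *m D /\ @row_free R (\rank Y) n D.
  by exists (col_base Y), (row_base Y); rewrite mulmx_base row_base_free.
have GU := gram_unitmx fD.
set G := D *m D^T in GU *.
have GT : G^T = G by rewrite /G trmx_mul trmxK.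
(* Orthogonal projector onto the row space of [Y]; by cyclicity its trace is that of an identity
   matrix of size [\rank Y]. *)
set L := D^T *m invmx G *m D.
have DL : D *m L = D by rewrite /L !mulmxA -/G mulmxV // mul1mx.
exists (1%:M - L); split.
- by rewrite linearB /= trmx1 /L !trmx_mul trmxK trmx_inv GT !mulmxA.
- rewrite mulmxBr mulmx1 mulmxBl mul1mx.
  by rewrite {3}/L -(mulmxA _ D) DL subrr subr0.
- by rewrite mulmxBr mulmx1 [in X in _ - X]YE -mulmxA DL -YE subrr.
- rewrite linearB /= mxtrace1 /L -mulmxA mxtrace_mulC -mulmxA -/G.
  by rewrite mulVmx // mxtrace1.
Qed.

(** The difference of the two sides is the squared norm of [X *m (1%:M - E)]. *)
Lemma mxtrace_mul_tr_proj_le (R : realFieldType) (m n : nat)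
    (X : 'M[R]_(m, n)) (E : 'M[R]_n) :
  E^T = E -> E *m E = E -> \tr (X *m E *m X^T) <= \tr (X *m X^T).
Proof.
move=> ET EE; set F := 1%:M - E.
have FF : F *m F^T = F.
  rewrite /F linearB /= trmx1 ET mulmxBr mulmx1 mulmxBl mul1mx EE.
  by rewrite subrr subr0.
rewrite -subr_ge0 -linearB /= -mulmxBl -{1}[X]mulmx1 -mulmxBr -/F.
by rewrite -FF mulmxA -mulmxA -trmx_mul mxtrace_mul_tr_ge0.
Qed.

(** [E j j] is the sum of the squares of row [j], so it dominates its own square. *)
Lemma proj_diag_itv (R : realFieldType) (n : nat) (E : 'M[R]_n) (j : 'I_n) :
  E^T = E -> E *m E = E -> 0 <= E j j <= 1.
Proof.
move=> ET EE.
have EjjE : E j j = \sum_l E j l ^+ 2.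
  rewrite -{1}EE mxE; apply: eq_bigr => l _.
  by rewrite -{2}ET mxE expr2.
have E0 : 0 <= E j j by rewrite EjjE; apply: sumr_ge0 => l _; exact: sqr_ge0.
rewrite E0 /=; have [//|E1] := leP.
have : E j j ^+ 2 <= E j j.
  rewrite [leRHS]EjjE (bigD1 j) //= lerDl.
  by apply: sumr_ge0 => l _; exact: sqr_ge0.
by rewrite expr2 ger_pMr ?(lt_trans ltr01)// leNgt E1.
Qed.

Lemma tail_sum_le_weighted (R : realFieldType) (n k : nat) (s : nat -> R)
    (w : 'I_n -> R) :
  (forall i, 0 <= s i) -> (forall i j, (i <= j)%N -> s j <= s i) ->
  (forall j, 0 <= w j <= 1) -> n%:R - k%:R <= \sum_j w j ->
  \sum_(j < n | (k <= j)%N) s j <= \sum_(j < n) s j * w j.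
Proof.
move=> s0 sS w01 sw.
(* The difference [n%:R - k%:R] counts the indices [j >= k] only if [k <= n]; otherwise the tail is
   empty. *)
have [kn|nk] := leqP k n; last first.
  rewrite big_pred0 => [|j]; last by rewrite leqNgt (ltn_trans _ nk).
  by apply: sumr_ge0 => j _; rewrite mulr_ge0 //; case/andP: (w01 j).
have cnt : \sum_(j < n) (k <= j)%:R = n%:R - k%:R :> R.
  rewrite -natr_sum -natrB //; congr _%:R.
  rewrite -(big_mkord xpredT (fun j => (k <= j)%N : nat)).
  rewrite (big_cat_nat _ kn) //= big_nat_cond big1 ?add0n; last first.
    by move=> i /andP[/andP[_ ik] _]; rewrite leqNgt ik.
  rewrite big_nat_cond (eq_bigr (fun=> 1%N)); last first.
    by move=> i /andP[/andP[-> _] _].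
  by rewrite -big_nat_cond sum_nat_const_nat muln1.
(* Comparing every [s j] with [s k] leaves [s k * (\sum_j w j - (n - k))]. *)
rewrite -subr_ge0 [X in _ - X]big_mkcond /= -sumrB.
apply: (@le_trans _ _ (\sum_(j < n) s k * (w j - (k <= j)%:R))).
  by rewrite -mulr_sumr mulr_ge0 // sumrB cnt subr_ge0.
apply: ler_sum => j _; have /andP[w0 w1] := w01 j.
case: (leqP k j) => kj.
  have := sS _ _ kj => skj; rewrite /= -[X in _ <= _ - X]mulr1 -mulrBr.
  by apply: ler_wnM2r => //; rewrite subr_le0.
by rewrite !subr0 ler_wpM2r // sS // ltnW.
Qed.

(** The middle factor in [is_svd]; with [tau] free, the truncation and its residual have the same
    form. *)
Definition rdiag_mx (R : nzRingType) (m n : nat) (tau : nat -> R) :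
    'M[R]_(m, n) :=
  \matrix_(i < m, j < n) (if val i == val j then tau i else 0).

Lemma rdiag_mx_gram (R : comNzRingType) (m n : nat) (tau : nat -> R) :
  (forall i, (minn m n <= i)%N -> tau i = 0) ->
  (rdiag_mx m n tau)^T *m rdiag_mx m n tau =
  diag_mx (\row_(j < n) (tau j ^+ 2)).
Proof.
move=> tau0; apply/matrixP => j l; rewrite !mxE.
have [jm|mj] := ltnP j m.
  rewrite (bigD1 (Ordinal jm)) //= !mxE /= eqxx big1 => [|i ij].
    by rewrite addr0 -val_eqE; case: eqP => _; rewrite ?mulr0 // expr2.
  by rewrite !mxE -[val i == _]/(i == Ordinal jm) (negPf ij) mul0r.
(* For [m <= j] column [j] is zero, which matches [tau j = 0]. *)
rewrite (tau0 j) ?geq_min ?mj // expr0n mul0rn big1 // => i _.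
by rewrite !mxE /= ltn_eqF ?mul0r // (leq_trans (ltn_ord i)).
Qed.

Lemma eckart_young_rdiag (R : realFieldType) (m n k : nat) (s : nat -> R)
    (Y : 'M[R]_(m, n)) :
  (forall i, 0 <= s i) -> (forall i, (minn m n <= i)%N -> s i = 0) ->
  (forall i j, (i <= j)%N -> s j <= s i) -> (\rank Y <= k)%N ->
  \sum_(j < n | (k <= j)%N) s j ^+ 2 <=
  \tr ((rdiag_mx m n s - Y) *m (rdiag_mx m n s - Y)^T).
Proof.
move=> s0 smn sS rY; have [E [ET EE YE trE]] := orth_projector_ker Y.
apply: le_trans (mxtrace_mul_tr_proj_le _ ET EE).
have -> : (rdiag_mx m n s - Y) *m E *m (rdiag_mx m n s - Y)^T =
    rdiag_mx m n s *m E *m (rdiag_mx m n s)^T.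
  rewrite mulmxBl YE subr0 linearB /= mulmxBr -(mulmxA _ E Y^T).
  by rewrite -{2}ET -trmx_mul YE trmx0 mulmx0 subr0.
rewrite -mulmxA mxtrace_mulC -mulmxA rdiag_mx_gram // mul_mx_diag.
under [leRHS]eq_bigr do rewrite !mxE mulrC.
apply: (tail_sum_le_weighted (s := fun i => s i ^+ 2) (w := fun j => E j j)).
- by move=> i; exact: sqr_ge0.
- by move=> i j ij; rewrite ler_sqr ?nnegrE // sS.
- by move=> j; exact: proj_diag_itv.
- by rewrite -[leRHS]/(\tr E) trE lerD2l lerN2 ler_nat.
Qed.

(** * Optimality of the truncated singular value decomposition *)

Lemma mxtrace_mul_tr_orth (R : comUnitRingType) (m n : nat) (P : 'M[R]_m)
    (Q : 'M[R]_n) (X : 'M[R]_(m, n)) :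
  P^T *m P = 1%:M -> Q^T *m Q = 1%:M ->
  \tr ((P *m X *m Q^T) *m (P *m X *m Q^T)^T) = \tr (X *m X^T).
Proof.
move=> PP QQ; rewrite !trmx_mul trmxK -!mulmxA mxtrace_mulC !mulmxA.
by rewrite -(mulmxA X) QQ mulmx1 -(mulmxA _ P^T) PP mulmx1.
Qed.

Lemma frobE (R : realType) (m n : nat) (X : 'M[R]_(m, n)) :
  frob X = Num.sqrt (\tr (X *m X^T)).
Proof. by rewrite /frob mxtrace_tr_mul_sum. Qed.

Lemma truncated_svdE (R : realType) (m n k : nat) (P : 'M[R]_m)
    (sigma : nat -> R) (Q : 'M[R]_n) (A : 'M[R]_(m, k)) (B : 'M[R]_(k, n)) :
  (forall i, (minn m n <= i)%N -> sigma i = 0) ->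
  (forall (i : 'I_k) (l : 'I_m), val l = val i -> col i A = col l P) ->
  (forall (i : 'I_k) (l : 'I_n), val l = val i -> row i B = (col l Q)^T) ->
  A *m diag_mx (\row_(i < k) sigma i) *m B =
  P *m rdiag_mx m n (fun i => if (i < k)%N then sigma i else 0) *m Q^T.
Proof.
move=> sigma0 AP BQ; set S := diag_mx _.
(* Rectangular identities: [P *m E] and [F *m Q^T] select singular vectors. They agree with [A] and
   [B] up to the factor [S], whose zeros hide the unconstrained columns and rows. *)
pose E : 'M[R]_(m, k) := rdiag_mx m k (fun=> 1).
pose F : 'M[R]_(k, n) := rdiag_mx k n (fun=> 1).
have AE : A *m S = P *m E *m S.
  rewrite !mul_mx_diag; apply/matrixP => a i; rewrite !mxE.
  have [im|mi] := ltnP i m; last by rewrite sigma0 ?mulr0 // geq_min mi.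
  congr (_ * _); rewrite (bigD1 (Ordinal im)) //= !mxE eqxx mulr1 big1.
    by rewrite addr0; have /colP/(_ a) := AP i (Ordinal im) erefl; rewrite !mxE.
  move=> l li; rewrite !mxE -[val l == _]/(l == Ordinal im) (negPf li).
  exact: mulr0.
have BE : S *m B = S *m (F *m Q^T).
  rewrite !mul_diag_mx; apply/matrixP => i b; rewrite !mxE.
  have [ln|nl] := ltnP i n; last by rewrite sigma0 ?mul0r // geq_min nl orbT.
  congr (_ * _); rewrite (bigD1 (Ordinal ln)) //= !mxE eqxx mul1r big1.
    by rewrite addr0; have /rowP/(_ b) := BQ i (Ordinal ln) erefl; rewrite !mxE.
  move=> l li; rewrite !mxE eq_sym -[val l == _]/(l == Ordinal ln) (negPf li).
  exact: mul0r.
rewrite AE -!mulmxA BE !mulmxA -(mulmxA P) -(mulmxA P); congr (_ *m _ *m _).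
rewrite mul_mx_diag; apply/matrixP => a b; rewrite !mxE.
have [ak|ka] := ltnP a k.
  rewrite (bigD1 (Ordinal ak)) //= !mxE /= eqxx mul1r big1 ?addr0.
    by case: eqP => _; rewrite ?mulr1 ?mulr0.
  move=> i ia; rewrite !mxE eq_sym -[val i == _]/(i == Ordinal ak) (negPf ia).
  by rewrite !mul0r.
rewrite if_same big1 // => i _; rewrite !mxE gtn_eqF ?mul0r //.
exact: leq_trans (ltn_ord i) ka.
Qed.

(** In the singular basis [Y] becomes [P^T *m Y *m Q], still of rank at most [k], and the residual
    of the truncation is the tail of [sigma], whose squared norm is the lower bound in
    [eckart_young_rdiag]. *)
Lemma truncated_svd_le (R : realType) (m n k : nat) (M : 'M[R]_(m, n))
    (A : 'M[R]_(m, k)) (s : 'rV[R]_k) (B : 'M[R]_(k, n)) (Y : 'M[R]_(m, n)) :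
  is_truncated_svd M A s B -> (\rank Y <= k)%N ->
  frob (M - A *m diag_mx s *m B) <= frob (M - Y).
Proof.
move=> [P [sigma [Q [[PP QQ [s0 smn] sS ME] -> AP BQ]]]] rY.
have PP' := mulmx1C PP; have QQ' := mulmx1C QQ.
rewrite -/(rdiag_mx m n sigma) in ME.
rewrite !frobE ler_wsqrtr // (truncated_svdE smn AP BQ).
set T := rdiag_mx m n (fun i => _).
have -> : M - P *m T *m Q^T = P *m (rdiag_mx m n sigma - T) *m Q^T.
  by rewrite mulmxBr mulmxBl -ME.
have -> : M - Y = P *m (rdiag_mx m n sigma - P^T *m Y *m Q) *m Q^T.
  rewrite mulmxBr mulmxBl -ME !mulmxA PP' mul1mx.
  by rewrite -(mulmxA Y) QQ' mulmx1.
rewrite !mxtrace_mul_tr_orth //.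
have rY' : (\rank (P^T *m Y *m Q) <= k)%N.
  by rewrite (leq_trans (mxrankM_maxl _ _)) // (leq_trans (mxrankM_maxr _ _)).
apply: le_trans (eckart_young_rdiag s0 smn sS rY').
have -> : rdiag_mx m n sigma - T =
    rdiag_mx m n (fun i => if (i < k)%N then 0 else sigma i).
  apply/matrixP => i j; rewrite !mxE; case: eqP => _; last by rewrite subr0.
  by case: ifP => _; rewrite ?subrr ?subr0.
rewrite mxtrace_mulC rdiag_mx_gram => [|i /smn ->]; last by rewrite if_same.
rewrite mxtrace_diag [leRHS]big_mkcond /=; apply: ler_sum => j _.
by rewrite mxE ltnNge; case: leqP => _ //=; rewrite expr0n.
Qed.

(** * Nonnegative right factors by shifting columns *)

Lemma mul_shifted_factor (R : pzRingType) (m n k : nat) (A : 'M[R]_(m, k))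
    (B : 'M[R]_(k, n)) (t : 'rV[R]_n) :
  row_mx A (- (A *m const_mx 1) : 'cV_m) *m (col_mx B 0 + const_mx 1 *m t) =
  A *m B.
Proof.
rewrite mulmxDr mul_row_col mulmx0 addr0 mulmxA -col_mx_const mul_row_col.
have -> : (const_mx 1 : 'M[R]_1) = 1%:M.
  by apply/matrixP => i j; rewrite !mxE !ord1.
by rewrite mulmx1 subrr mul0mx addr0.
Qed.

(** Entry [j] is the least multiple of the all-ones vector that makes column [j] of [col_mx B 0]
    nonnegative. *)
Definition col_shift (R : realDomainType) (k n : nat) (B : 'M[R]_(k, n)) :
    'rV[R]_n :=
  \row_j \big[Num.max/0]_(l < k) (- B l j).

Lemma shifted_factor_ge0 (R : realType) (k n : nat) (B : 'M[R]_(k, n)) :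
  nonneg_mx (col_mx B 0 + (const_mx 1 : 'cV_(k + 1)) *m col_shift B).
Proof.
move=> i j; rewrite !mxE big_ord1 !mxE mul1r.
have t0 : 0 <= \big[Num.max/0]_(l < k) (- B l j).
  exact: bigmax_ge_id.
case: splitP => l _; last by rewrite mxE add0r.
by rewrite -lerBlDl sub0r le_bigmax.
Qed.

(** A factorization through [\rank X] is padded with zeros to inner dimension exactly [k]. *)
Lemma rank_factor (F : fieldType) (m n k : nat) (X : 'M[F]_(m, n)) :
  (\rank X <= k)%N -> exists (A : 'M[F]_(m, k)) (B : 'M[F]_(k, n)), X = A *m B.
Proof.
move=> rX; exists (col_base X *m pid_mx (\rank X)).
exists (pid_mx (\rank X) *m row_base X).
rewrite mulmxA -(mulmxA (col_base X)) mul_pid_mx minnn (minn_idPr rX).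
by rewrite pid_mx_1 mulmx1 mulmx_base.
Qed.

(** The triangle inequality for [X] and [- X] gives [0 <= N X + N X]. *)
Lemma is_norm_ge0 (R : realType) (m n : nat) (N : 'M[R]_(m, n) -> R) X :
  is_norm N -> 0 <= N X.
Proof.
move=> [ND NZ _].
have := ND X (- X); rewrite subrr -scaleN1r NZ normrN1 mul1r.
have -> : N 0 = 0 by rewrite -(scale0r X) NZ normr0 mul0r.
by rewrite -mulr2n pmulrn_lge0.
Qed.

Lemma col_shiftE (R : realDomainType) (k n : nat) (B : 'M[R]_(k, n)) :
  \matrix_(i < k + 1, j < n) \big[Num.max/0]_(l < k) (- B l j) =
  const_mx 1 *m col_shift B.
Proof. by apply/matrixP => i j; rewrite !mxE big_ord1 !mxE mul1r. Qed.

(** Whatever signs are chosen, flipping both factors leaves their product unchanged. *)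
Lemma init_sign_mx_sqr (R : realType) (k n : nat) (B : 'M[R]_(k, n)) :
  diag_mx (\row_i init_sign B i) *m diag_mx (\row_i init_sign B i) = 1%:M.
Proof.
rewrite mul_diag_mx; apply/matrixP => i j; rewrite !mxE mulrnAr /init_sign.
by congr (_ *+ _); case: ifP => _; rewrite ?mulrNN mulr1.
Qed.

Lemma INIT_le (R : realType) (m n k : nat) (M Y : 'M[R]_(m, n))
    (U : 'M[R]_(m, k + 1)) (V : 'M[R]_(k + 1, n)) :
  INIT M U V -> (\rank Y <= k)%N ->
  nonneg_mx V /\ frob (M - U *m V) <= frob (M - Y).
Proof.
move=> [A [s [B [tsvd [-> ->]]]]] rY; rewrite col_shiftE; split.
  exact: shifted_factor_ge0.
rewrite mul_shifted_factor mulmxA -(mulmxA (A *m _)) init_sign_mx_sqr mulmx1.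
exact: truncated_svd_le.
Qed.

(** * Monotonicity of coordinate descent *)

Lemma frob_sqr_le (R : realType) (m n : nat) (X Y : 'M[R]_(m, n)) :
  (frob X ^+ 2 <= frob Y ^+ 2) = (frob X <= frob Y).
Proof. by rewrite ler_sqr // nnegrE sqrtr_ge0. Qed.

Lemma mulmx_sum_col_rowD1 (R : pzRingType) (m n r : nat) (U : 'M[R]_(m, r))
    (V : 'M[R]_(r, n)) (i : 'I_r) :
  U *m V = \sum_(l < r | l != i) col l U *m row l V + col i U *m row i V.
Proof.
rewrite addrC -(bigD1 (P := predT) i (F := fun l => col l U *m row l V)) //=.
apply/matrixP => a b; rewrite mxE summxE; apply: eq_bigr => l _.
by rewrite !mxE big_ord1 !mxE.
Qed.

Lemma V_row_update_le (R : realType) (m n r : nat) (M : 'M[R]_(m, n))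
    (U : 'M[R]_(m, r)) (i : 'I_r) (V V' : 'M[R]_(r, n)) :
  V_row_update M U i V V' -> nonneg_mx V ->
  nonneg_mx V' /\ frob (M - U *m V') <= frob (M - U *m V).
Proof.
move=> [same [V'i le_i]] V0; split.
  move=> l j; have [->|li] := eqVneq l i.
    by have := V'i 0 j; rewrite mxE.
  by have /rowP/(_ j) := same l li; rewrite !mxE => ->.
rewrite -frob_sqr_le !(mulmx_sum_col_rowD1 _ _ i) !opprD !addrA.
(* Both errors become values of the objective of the update, at the new and at the old row [i]. *)
rewrite (eq_bigr (fun l => col l U *m row l V)); last first.
  by move=> l li; rewrite same.
by apply: le_i => a j; rewrite mxE.
Qed.

(** [U0] is arbitrary because the update of [U] minimizes over all matrices; this allows a
    comparison with the left factor from [INIT], which [CD] does not take as input. *)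
Lemma CD_step_le (R : realType) (m n r : nat) (M : 'M[R]_(m, n))
    (V V' : 'M[R]_(r, n)) (U0 U : 'M[R]_(m, r)) :
  CD_step M V U V' -> nonneg_mx V ->
  nonneg_mx V' /\ frob (M - U *m V') <= frob (M - U0 *m V).
Proof.
move=> [[_ U_min] [W [W0 WS <-]]] V0.
(* Nonnegativity is part of the induction since it makes the current row feasible for the next
   update. *)
have W_le i : (i <= r)%N ->
    nonneg_mx (W i) /\ frob (M - U *m W i) <= frob (M - U *m V).
  elim: i => [|i IH] ir; first by rewrite W0.
  have [Wi0 Wi_le] := IH (ltnW ir).
  have [WS0 WS_le] := V_row_update_le (WS (Ordinal ir)) Wi0.
  by split=> //; exact: le_trans WS_le Wi_le.
have [Wr0 Wr_le] := W_le r (leqnn r); split=> //.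
by apply: le_trans Wr_le _; rewrite -frob_sqr_le; exact: U_min.
Qed.

Lemma CD_le (R : realType) (m n r : nat) (M : 'M[R]_(m, n))
    (V0 : 'M[R]_(r, n)) (K : nat) (U0 U : 'M[R]_(m, r)) (V : 'M[R]_(r, n)) :
  CD M V0 K U V -> nonneg_mx V0 ->
  nonneg_mx V /\ frob (M - U *m V) <= frob (M - U0 *m V0).
Proof.
move=> cd V00; elim: cd => [{}U {}V /CD_step_le|]; first exact.
move=> {}K {}U {}V U' V' _ [V_ge0 V_le] step.
have [V'0 V'_le] := CD_step_le U step V_ge0.
by split=> //; exact: le_trans V'_le V_le.
Qed.

(* The factorization rank is r = k + 1, so that k = r - 1. *)
Theorem corollary2 (R : realType) (m n k : nat) (M : 'M[R]_(m, n)) :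
  (forall (N : 'M[R]_(m, n) -> R) (Mk : 'M[R]_(m, n)),
     is_norm N -> best_rank_approx N k M Mk ->
     inf [set x : R | exists (U : 'M[R]_(m, k + 1)) (V : 'M[R]_(k + 1, n)),
            nonneg_mx V /\ x = N (M - U *m V)]
       <= N (M - Mk)) /\
  (forall (U0 : 'M[R]_(m, k + 1)) (V0 : 'M[R]_(k + 1, n)) (K : nat)
      (U : 'M[R]_(m, k + 1)) (V : 'M[R]_(k + 1, n)) (Mk : 'M[R]_(m, n)),
     INIT M U0 V0 -> CD M V0 K U V ->
     best_rank_approx (@frob R m n) k M Mk ->
     frob (M - U *m V) <= frob (M - Mk)).
Proof.
split=> [N Mk normN [rMk _]|U0 V0 K U V Mk init cd [rMk _]].
  have [A [B MkE]] := rank_factor rMk.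
  apply: ge_inf.
    (* [ge_inf] asks for a lower bound of the set of errors. *)
    by exists 0 => _ [U [V [_ ->]]]; exact: is_norm_ge0.
  (* The shift of [INIT], applied to any factorization of [Mk] instead of the truncated SVD. *)
  exists (row_mx A (- (A *m const_mx 1) : 'cV_m)).
  exists (col_mx B 0 + const_mx 1 *m col_shift B); split.
    exact: shifted_factor_ge0.
  by rewrite mul_shifted_factor -MkE.
have [V0_ge0 le0] := INIT_le init rMk.
by have [_ le1] := CD_le U0 cd V0_ge0; exact: le_trans le1 le0.
Qed.
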